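(* Say a word $\sigma=\sigma_1\cdots\sigma_n$ over $\{1,\dots,k\}$ avoids $13\text{-}2$ if there are no indices $i,j$ with $j>i+1$ and $\sigma_i<\sigma_j<\sigma_{i+1}$, and let $F_{13\text{-}2}(x;k)=\sum_{n\ge0}f_{13\text{-}2}(n,k)x^n$, where $f_{13\text{-}2}(n,k)$ is the number of such words of length $n$. Then \[ F_{13\text{-}2}(x;1)=\frac{1}{1-x},\quad F_{13\text{-}2}(x;2)=\frac{1}{1-2x},\quad F_{13\text{-}2}(x;3)=\frac{(1-x)^2}{(1-2x)(1-3x+x^2)}, \] \[ F_{13\text{-}2}(x;4)=\frac{1-4x+6x^2-3x^3}{(1-3x)(1-2x)(1-3x+x^2)}. \]
   Context: The empty word (length $0$) is counted once. *)

(* Defs.v *)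
From HB Require Import structures.
From mathcomp Require Import all_boot all_order all_algebra.
From mathcomp Require Import boolp.

Set Implicit Arguments.
Unset Strict Implicit.
Unset Printing Implicit Defensive.

Import Order.TTheory GRing.Theory Num.Theory.

Local Open Scope ring_scope.

(* The ring R[[x]] of formal power series, with the Cauchy product. A series
   is a unit iff its constant coefficient is, so that a quotient P / Q is
   meaningful exactly when Q has an invertible constant coefficient. *)

Record fps (R : Type) := FPS { fcoef : nat -> R }.

Lemma fpsP (R : Type) (f g : fps R) : fcoef f =1 fcoef g -> f = g.
Proof. by case: f g => [f] [g] /= /funext ->. Qed.

HB.instance Definition _ (R : Type) := gen_eqMixin (fps R).
HB.instance Definition _ (R : Type) := gen_choiceMixin (fps R).

Section FpsRing.
Variable R : comUnitRingType.
Implicit Types f g h : fps R.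

Definition fps0 : fps R := FPS (fun=> 0).
Definition fps1 : fps R := FPS (fun n => (n == 0)%N%:R).
Definition fps_opp f := FPS (fun n => - fcoef f n).
Definition fps_add f g := FPS (fun n => fcoef f n + fcoef g n).
Definition fps_mul f g :=
  FPS (fun n => \sum_(i < n.+1) fcoef f i * fcoef g (n - i)).

Let fps_addA : associative fps_add.
Proof. by move=> f g h; apply: fpsP => n /=; rewrite addrA. Qed.
Let fps_addC : commutative fps_add.
Proof. by move=> f g; apply: fpsP => n /=; rewrite addrC. Qed.
Let fps_add0 : left_id fps0 fps_add.
Proof. by move=> f; apply: fpsP => n /=; rewrite add0r. Qed.
Let fps_addN : left_inverse fps0 fps_opp fps_add.
Proof. by move=> f; apply: fpsP => n /=; rewrite addNr. Qed.

HB.instance Definition _ :=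
  GRing.isZmodule.Build (fps R) fps_addA fps_addC fps_add0 fps_addN.

Let trunc m f : {poly R} := \poly_(i < m) fcoef f i.

Let fps_mul_trunc f g m n : (n < m)%N ->
  fcoef (fps_mul f g) n = (trunc m f * trunc m g)`_n.
Proof.
move=> nm; rewrite coefM; apply: eq_bigr => i _.
have im : (i < m)%N by apply: leq_trans nm; rewrite ltnS -ltnS.
by rewrite !coef_poly im (leq_ltn_trans (leq_subr _ _) nm).
Qed.

Let fps_mulC : commutative fps_mul.
Proof.
by move=> f g; apply: fpsP => n; rewrite !(@fps_mul_trunc _ _ n.+1)// mulrC.
Qed.

Let coefM_trunc m n (p q p' q' : {poly R}) : (n < m)%N ->
  (forall i, (i < m)%N -> p`_i = p'`_i) ->
  (forall i, (i < m)%N -> q`_i = q'`_i) -> (p * q)`_n = (p' * q')`_n.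
Proof.
move=> nm pp' qq'; rewrite !coefM; apply: eq_bigr => i _.
by rewrite pp' ?qq' ?(leq_ltn_trans (leq_subr _ _) nm)//; apply: leq_trans nm.
Qed.

Let fps_mulA : associative fps_mul.
Proof.
move=> f g h; apply: fpsP => n; rewrite !(@fps_mul_trunc _ _ n.+1)//.
have tM a b i : (i < n.+1)%N ->
    (trunc n.+1 (fps_mul a b))`_i = (trunc n.+1 a * trunc n.+1 b)`_i.
  by move=> im; rewrite coef_poly im (fps_mul_trunc _ _ im).
rewrite (coefM_trunc (ltnSn n) (fun i _ => erefl) (tM g h)).
by rewrite (coefM_trunc (ltnSn n) (tM f g) (fun i _ => erefl)) mulrA.
Qed.

Let fps_mul1 : left_id fps1 fps_mul.
Proof.
move=> f; apply: fpsP => n /=.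
by rewrite big_ord_recl big1 ?mul1r ?subn0 ?addr0// => i _; rewrite mul0r.
Qed.

Let fps_mulDl : left_distributive fps_mul fps_add.
Proof.
move=> f g h; apply: fpsP => n /=.
by rewrite -big_split; apply: eq_bigr => i _; rewrite mulrDl.
Qed.

Let fps1_neq0 : fps1 != 0 :> fps R.
Proof.
by apply/eqP => /(congr1 (fun f => fcoef f 0)) /= /eqP; rewrite oner_eq0.
Qed.

HB.instance Definition _ := GRing.Zmodule_isComNzRing.Build (fps R)
  fps_mulA fps_mulC fps_mul1 fps_mulDl fps1_neq0.

Definition fpsC (c : R) : fps R := FPS (fun n => if n is 0 then c else 0).
Definition fpsX : fps R := FPS (fun n => (n == 1)%N%:R).

Lemma fcoefD f g n : fcoef (f + g) n = fcoef f n + fcoef g n.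
Proof. by []. Qed.
Lemma fcoefN f n : fcoef (- f) n = - fcoef f n.
Proof. by []. Qed.
Lemma fcoef1 n : fcoef (1 : fps R) n = (n == 0)%N%:R.
Proof. by []. Qed.
Lemma fcoefM f g n :
  fcoef (f * g) n = \sum_(i < n.+1) fcoef f i * fcoef g (n - i).
Proof. by []. Qed.
Lemma fcoef_sum I (r : seq I) (P : pred I) (F : I -> fps R) n :
  fcoef (\sum_(i <- r | P i) F i) n = \sum_(i <- r | P i) fcoef (F i) n.
Proof. by elim/big_rec2: _ => // i y x _ <-. Qed.
Lemma fcoefCM c f n : fcoef (fpsC c * f) n = c * fcoef f n.
Proof.
rewrite fcoefM big_ord_recl big1 ?addr0 ?subn0// => i _; exact: mul0r.
Qed.

Definition fps_unit : pred (fps R) := fun f => fcoef f 0 \is a GRing.unit.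

(* The inverse of c (1 - g), with c the constant coefficient, is the sum of the
   c^-1 g^i; only the g^i with i <= n contribute to its n-th coefficient. *)
Definition fps_inv f : fps R :=
  if fps_unit f then
    let c := (fcoef f 0)^-1 in
    FPS (fun n => c * fcoef (\sum_(i < n.+1) (1 - fpsC c * f) ^+ i) n)
  else f.

Let fcoefX_small g i n : fcoef g 0 = 0 -> (n < i)%N -> fcoef (g ^+ i) n = 0.
Proof.
move=> g0; elim: i n => // i IHi n ni; rewrite exprS fcoefM big1// => j _.
have [j0|j0] := posnP j; first by rewrite j0 g0 mul0r.
rewrite IHi ?mulr0//; have jn : (j <= n)%N by rewrite -ltnS.
by rewrite -ltnS (leq_trans _ ni)// ltnS ltn_subrL j0 (leq_trans j0 jn).
Qed.

Let fps_mulV : {in fps_unit, left_inverse 1 fps_inv *%R}.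
Proof.
move=> f uf; rewrite /fps_inv; have -> : fps_unit f by [].
set c := (fcoef f 0)^-1; set g := 1 - fpsC c * f.
have g0 : fcoef g 0 = 0.
  by rewrite fcoefD fcoefN fcoefCM mulVr// subrr.
have fE : fpsC c * f = 1 - g by rewrite opprB addrC subrK.
apply: fpsP => n.
transitivity (fcoef ((\sum_(i < n.+1) g ^+ i) * (fpsC c * f)) n).
  rewrite !fcoefM; apply: eq_bigr => j _.
  rewrite fcoefCM [RHS]mulrCA mulrA; congr (_ * _ * _).
  rewrite !fcoef_sum -!(big_mkord xpredT (fun i => fcoef (g ^+ i) j)).
  rewrite [RHS](big_cat_nat (n := j.+1)) //= [X in _ + X]big1_seq ?addr0 //.
  move=> i /andP[_]; rewrite mem_index_iota => /andP[ji _].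
  exact: fcoefX_small.
rewrite fE mulrC -opprB mulNr -subrX1 opprB fcoefD fcoefN.
by rewrite fcoefX_small// subr0.
Qed.

Let fps_unitPl f g : g * f = 1 -> fps_unit f.
Proof.
move=> /(congr1 (fun h => fcoef h 0)); rewrite fcoefM big_ord1 => gf.
by apply/unitrPr; exists (fcoef g 0); rewrite mulrC.
Qed.

Let fps_inv_out : {in [predC fps_unit], fps_inv =1 id}.
Proof. by move=> f /negbTE uf; rewrite /fps_inv ifF. Qed.

HB.instance Definition _ := GRing.ComNzRing_hasMulInverse.Build (fps R)
  fps_mulV fps_unitPl fps_inv_out.

Lemma fps_unitE f :
  (f \is a GRing.unit) = (fcoef f 0 \is a GRing.unit).
Proof. by []. Qed.

End FpsRing.

Arguments fpsX {R}.

(* Words of length n over an alphabet of k letters. The letters are the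
   elements 0, ..., k - 1 of 'I_k rather than 1, ..., k; only their order
   matters. Positions are numbered from 0, and i' is the successor of i. *)
Definition avoids13_2 (n k : nat) (w : n.-tuple 'I_k) : bool :=
  ~~ [exists i : 'I_n, exists i' : 'I_n, exists j : 'I_n,
       [&& i' == i.+1 :> nat, (i.+1 < j)%N
         & (tnth w i < tnth w j < tnth w i')%N]].

Definition f13_2 (n k : nat) : nat :=
  #|[set w : n.-tuple 'I_k | avoids13_2 w]|.

Definition F13_2 (k : nat) : fps int := FPS (fun n => (f13_2 n k)%:Z).

(* Main.v *)
(** Reading a word from left to right, all that matters for extending it is its
    last letter [a] and the set [S] of letters that may no longer occur because
    they lie strictly between the two letters of an earlier (adjacent) ascent. The
    generating functions [G S a] of the admissible continuations satisfy
    [G S a = 1 + x * \sum_(c \notin S) G (S :|: ]a, c[) c], a linear system with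
    finitely many unknowns, and the words avoiding 13-2 are the continuations of
    the state where [S] is empty and [a] is the largest letter, which starts no
    ascent. *)
Require Import Defs.
From mathcomp Require Import all_boot all_order all_algebra.
From mathcomp Require Import ring zify.

Set Implicit Arguments.
Unset Strict Implicit.

Import GRing.Theory.
Local Open Scope ring_scope.

(** * Words and their admissible continuations *)

Section Words.
Variable k : nat.
Implicit Types (a c : 'I_k) (S : {set 'I_k}) (s : seq 'I_k).

Definition between a c : {set 'I_k} := [set y : 'I_k | (a < y < c)%N].

(** Non-ascents need no separate case, since [between a c] is then empty. *)
Fixpoint avoids s : bool :=
  if s is a :: t then
    (if t is c :: u then all (fun y => y \notin between a c) u else true)
    && avoids t
  else true.

Lemma avoids_cons a c s :
  avoids [:: a, c & s] = all (fun y => y \notin between a c) s && avoids (c :: s).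
Proof. by []. Qed.

Lemma avoidsP (x0 : 'I_k) s :
  reflect (forall i j, (i.+1 < j < size s)%N ->
             nth x0 s j \notin between (nth x0 s i) (nth x0 s i.+1))
          (avoids s).
Proof.
elim: s => [|a [|c s] IHs]; try by constructor => i j /=; lia.
rewrite avoids_cons; apply: (iffP andP) => [[/(all_nthP x0) h /IHs h'] i j|h].
  case: i j => [|i] [|j] //= lt_ij; last by apply: h'.
  by case: j lt_ij => [|j] //= lt_j; apply: h; lia.
split; last by apply/IHs => i j lt_ij; apply: (h i.+1 j.+1).
by apply/(all_nthP x0) => j lt_j; apply: (h 0%N j.+2).
Qed.

Lemma avoids13_2E n (w : n.-tuple 'I_k) : avoids13_2 w = avoids w.
Proof.
apply/idP/idP => [/existsP h|].
  (* For [n = 0] there is no letter to serve as the default of [nth]. *)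
  have [n0|n_gt0] := posnP n; first by case: n w n0 h => // w _ _; rewrite tuple0.
  pose x0 := tnth w (Ordinal n_gt0).
  apply/(avoidsP x0) => i j; rewrite size_tuple => /andP[lt_ij lt_jn].
  have lt_i1 : (i.+1 < n)%N by lia.
  have lt_i : (i < n)%N by lia.
  apply/negP => bad; apply: h; exists (Ordinal lt_i).
  apply/existsP; exists (Ordinal lt_i1); apply/existsP; exists (Ordinal lt_jn).
  by rewrite !(tnth_nth x0) /= eqxx lt_ij; move: bad; rewrite inE.
move=> av; apply/existsP => -[i] /existsP[i'] /existsP[j] /and3P[/eqP i'E lt_ij].
pose x0 := tnth w i.
move/(avoidsP x0)/(_ i j): av; rewrite lt_ij size_tuple ltn_ord inE.
by rewrite !(tnth_nth x0) i'E => /(_ isT)/negbTE->.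
Qed.

(** The last letter [a] goes in front because it may form an ascent with the first letter of [s]; it
    is not itself tested against [S]. *)
Definition continuation S a s := all (fun y => y \notin S) s && avoids (a :: s).

Lemma continuation_cons S a c s :
  continuation S a (c :: s) =
  (c \notin S) && continuation (S :|: between a c) c s.
Proof.
rewrite /continuation avoids_cons [all _ (c :: s)]/= -!andbA; congr (_ && _).
rewrite andbA -all_predI; congr (_ && _).
by apply: eq_all => y /=; rewrite in_setU negb_or.
Qed.

Definition G S a : fps int :=
  FPS (fun n => #|[set w : n.-tuple 'I_k | continuation S a w]|%:Z).

End Words.

(** * The recursion for the generating functions *)

Lemma card_tuple_cons (T : finType) n (P : pred (seq T)) :
  #|[set w : n.+1.-tuple T | P w]| =
  (\sum_(c : T) #|[set w : n.-tuple T | P (c :: w)]|)%N.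
Proof.
under eq_bigr => c _ do rewrite -sum1_card.
rewrite -sum1_card pair_big_dep /=.
rewrite (reindex (fun p : T * n.-tuple T => cons_tuple p.1 p.2)) /=.
  by apply: eq_bigl => -[c w]; rewrite !inE.
exists (fun w => (thead w, behead_tuple w)) => [[c w] _|w _] /=.
  by congr (_, _); apply: val_inj.
by rewrite [RHS]tuple_eta; apply: val_inj.
Qed.

Lemma fcoefXM (R : comUnitRingType) (f : fps R) n :
  fcoef (fpsX * f) n = if n is m.+1 then fcoef f m else 0.
Proof.
case: n => [|n]; rewrite fcoefM big_ord_recl /= mul0r add0r ?big_ord0 //.
rewrite big_ord_recl mul1r subSS subn0 big1 ?addr0 // => i _.
by rewrite /= mul0r.
Qed.

Lemma G_rec k (S : {set 'I_k}) a :
  G S a = 1 + fpsX * \sum_(c | c \notin S) G (S :|: between a c) c.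
Proof.
apply: fpsP => -[|n]; rewrite fcoefD fcoefXM fcoef1 ?add0r ?addr0.
  rewrite /G /= (_ : [set _ | _] = setT) ?cardsT ?card_tuple //.
  by apply/setP => w; rewrite !inE tuple0.
rewrite fcoef_sum /G /= card_tuple_cons raddf_sum [RHS]big_mkcond /=.
apply: eq_bigr => c _; under eq_finset => w do rewrite continuation_cons.
by case: (c \in S) => //=; rewrite (_ : [set _ | _] = set0) ?cards0 //;
  apply/setP => w; rewrite !inE.
Qed.

(** Nothing exceeds [ord_max], so placing it in front of a word creates no ascent and hence no
    constraint. *)
Lemma F13_2E k : F13_2 k.+1 = G set0 (ord_max : 'I_k.+1).
Proof.
apply: fpsP => n; rewrite /= /f13_2; congr (Posz #|pred_of_set _|).
apply/setP => w; rewrite !inE avoids13_2E /continuation.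
case: (tval w) => // c s; rewrite avoids_cons.
have inF y : y \in between ord_max c = false by rewrite inE ltnNge leq_ord.
by rewrite !(eq_all (a2 := predT)) ?all_predT // => y; rewrite ?inF ?inE.
Qed.

Lemma unit_1subX (R : comUnitRingType) (f : fps R) :
  1 - fpsX * f \is a GRing.unit.
Proof. by rewrite fps_unitE fcoefD fcoefN fcoefXM fcoef1 subr0 unitr1. Qed.

(** With at most two letters nothing lies strictly between two letters, so no letter is ever
    forbidden and the recursion does not depend on the last letter. *)
Lemma F13_2_le2 k : (k < 2)%N ->
  F13_2 k.+1 = 1 + fpsX * (F13_2 k.+1 *+ k.+1).
Proof.
move=> lt_k2.
have rec (a : 'I_k.+1) : G set0 a = 1 + fpsX * \sum_(c < k.+1) G set0 c.
  rewrite G_rec; congr (1 + fpsX * _); apply: eq_big => c; first by rewrite inE.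
  move=> _; congr (G _ c); apply/setP => y; rewrite !inE /=.
  by have := ltn_ord c; lia.
rewrite F13_2E [LHS]rec; congr (1 + fpsX * _).
by under eq_bigr do rewrite rec -(rec ord_max); rewrite sumr_const card_ord.
Qed.

(** * The linear systems for three and four letters *)

Local Notation o3 i := (@Ordinal 3 i isT).
Local Notation o4 i := (@Ordinal 4 i isT).

Lemma big_ord_3 (V : zmodType) (F : 'I_3 -> V) :
  \sum_(i < 3) F i = F (o3 0) + F (o3 1) + F (o3 2).
Proof.
rewrite !big_ord_recr big_ord0 /= add0r.
by congr (F _ + F _ + F _); apply: val_inj.
Qed.

Lemma big_ord_4 (V : zmodType) (F : 'I_4 -> V) :
  \sum_(i < 4) F i = F (o4 0) + F (o4 1) + F (o4 2) + F (o4 3).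
Proof.
rewrite !big_ord_recr big_ord0 /= add0r.
by congr (F _ + F _ + F _ + F _); apply: val_inj.
Qed.

(* [b1] and [b2] record whether the middle letters 1 and 2 are forbidden; the
   extreme letters never are. *)
Definition G3 b1 (a : 'I_3) := G [set y : 'I_3 | b1 && (y == 1 :> nat)%N] a.

(** Only the ascent from 0 to 2 has a letter strictly inside, so [a] enters only through the test
    [a < 1]. *)
Lemma G3_rec b1 (a : 'I_3) :
  G3 b1 a = 1 + fpsX *
    (G3 b1 (o3 0) + (if b1 then 0 else G3 b1 (o3 1))
     + G3 (b1 || (a < 1)%N) (o3 2)).
Proof.
rewrite {1}/G3 G_rec big_mkcond big_ord_3 !inE /= andbF andbT if_neg.
congr (1 + fpsX * _); congr (_ + _ + _).
- by congr (G _ _); apply/setP => y; rewrite !inE /=; lia.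
- by case: b1 => //; congr (G _ _); apply/setP => y; rewrite !inE /=; lia.
by congr (G _ _); apply/setP => y; rewrite !inE /=; have := ltn_ord y; lia.
Qed.

Definition G4 b1 b2 (a : 'I_4) :=
  G [set y : 'I_4 | b1 && (y == 1 :> nat)%N || b2 && (y == 2 :> nat)%N] a.

(** Ascending to 2 can newly forbid only 1, ascending to 3 both middle letters. *)
Lemma G4_rec b1 b2 (a : 'I_4) :
  G4 b1 b2 a = 1 + fpsX *
    (G4 b1 b2 (o4 0) + (if b1 then 0 else G4 b1 b2 (o4 1))
     + (if b2 then 0 else G4 (b1 || (a < 1)%N) b2 (o4 2))
     + G4 (b1 || (a < 1)%N) (b2 || (a < 2)%N) (o4 3)).
Proof.
rewrite {1}/G4 G_rec big_mkcond big_ord_4 !inE /= !(andbF, andbT, orbF) !if_neg.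
congr (1 + fpsX * _); congr (_ + _ + _ + _).
- by congr (G _ _); apply/setP => y; rewrite !inE /=; lia.
- by case: b1 => //; congr (G _ _); apply/setP => y; rewrite !inE /=; lia.
- by case: b2 => //; congr (G _ _); apply/setP => y; rewrite !inE /=; lia.
by congr (G _ _); apply/setP => y; rewrite !inE /=; have := ltn_ord y; lia.
Qed.

(** Here [u] follows the smallest letter, [v] any other, and [d] is the state with the middle letter
    forbidden. The same system governs four letters with one middle letter forbidden. *)
Lemma three_state_system (R : comUnitRingType) (x u v d : R) :
    u = 1 + x * (u + v + d) -> v = 1 + x * (u + v + v) -> d = 1 + x * (d + d) ->
  v * ((1 - 2 * x) * (1 - 3 * x + x ^+ 2)) = (1 - x) ^+ 2.
Proof.
move=> eu ev ed; apply/subr0_eq.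
(* The weights [x] and [1 - x] cancel [u]; the factor [1 - 2 * x] and the last summand cancel
   [d]. *)
transitivity ((1 - 2 * x) * (x * (u - (1 + x * (u + v + d)))
    + (1 - x) * (v - (1 + x * (u + v + v)))) + x ^+ 2 * (d - (1 + x * (d + d)))).
  by ring.
by rewrite -eu -ev -ed !(subrr, mulr0, addr0).
Qed.

(** In [e0], [e1], [e] nothing is forbidden and the last letter is 0, 1 or larger; [b] has one
    middle letter forbidden and last letter not 0, [d] has both forbidden. *)
Lemma five_state_system (R : comUnitRingType) (x e0 e1 e b d : R) :
    1 - x \is a GRing.unit ->
    e0 = 1 + x * (e0 + e1 + b + d) -> e1 = 1 + x * (e0 + e1 + e + b) ->
    e = 1 + x * (e0 + e1 + e + e) -> d = 1 + x * (d + d) ->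
    b * ((1 - 2 * x) * (1 - 3 * x + x ^+ 2)) = (1 - x) ^+ 2 ->
  e * ((1 - 3 * x) * (1 - 2 * x) * (1 - 3 * x + x ^+ 2))
  = 1 - 4 * x + 6 * x ^+ 2 - 3 * x ^+ 3.
Proof.
(* Eliminating [e0 + e1] leaves [e] with coefficient [(1 - 2 * x) ^+ 2 - x ^+ 2 = (1 - x) * (1 - 3 *
   x)], whence the extra factor [1 - x] to cancel. *)
move=> ux h0 h1 h hd hb; apply: (mulrI ux); apply/subr0_eq.
pose q := 1 - 3 * x + x ^+ 2.
transitivity ((1 - 2 * x) * q * (1 - 2 * x) * (e - (1 + x * (e0 + e1 + e + e)))
    + (1 - 2 * x) * q * x * ((e0 - (1 + x * (e0 + e1 + b + d)))
                              + (e1 - (1 + x * (e0 + e1 + e + b))))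
    + 2 * x ^+ 2 * (b * ((1 - 2 * x) * q) - (1 - x) ^+ 2)
    + x ^+ 2 * q * (d - (1 + x * (d + d)))).
  by rewrite /q; ring.
by rewrite -h0 -h1 -h -hd hb !(subrr, mulr0, addr0).
Qed.

Theorem theorem3p8 :
  let x : fps int := fpsX in
  [/\ F13_2 1 = 1 / (1 - x),
      F13_2 2 = 1 / (1 - 2 * x),
      F13_2 3 = (1 - x) ^+ 2 / ((1 - 2 * x) * (1 - 3 * x + x ^+ 2))
    & F13_2 4 = (1 - 4 * x + 6 * x ^+ 2 - 3 * x ^+ 3)
                / ((1 - 3 * x) * (1 - 2 * x) * (1 - 3 * x + x ^+ 2))].
Proof.
move=> x.
have u1 : 1 - x \is a GRing.unit by rewrite -[x]mulr1 unit_1subX.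
have u2 : 1 - 2 * x \is a GRing.unit by rewrite mulrC unit_1subX.
have u3 : 1 - 3 * x \is a GRing.unit by rewrite mulrC unit_1subX.
have uq : 1 - 3 * x + x ^+ 2 \is a GRing.unit.
  have -> : 1 - 3 * x + x ^+ 2 = 1 - x * (3 - x) by ring.
  exact: unit_1subX.
split; apply: (canRL (mulrK _)); rewrite ?unitrM ?u1 ?u2 ?u3 ?uq //.
- by rewrite mulrBr mulr1 {1}(F13_2_le2 (k := 0)) // -/x; ring.
- by rewrite mulrBr mulr1 {1}(F13_2_le2 (k := 1)) // -/x; ring.
- have F3E : F13_2 3 = G3 false (o3 2).
    by rewrite F13_2E; congr (G _ _); apply: val_inj.
  have v1E : G3 false (o3 1) = G3 false (o3 2).
    by rewrite [LHS]G3_rec [RHS]G3_rec.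
  have d0E : G3 true (o3 0) = G3 true (o3 2).
    by rewrite [LHS]G3_rec [RHS]G3_rec.
  rewrite F3E.
  apply: (three_state_system (u := G3 false (o3 0)) (d := G3 true (o3 2))).
  + by rewrite [LHS]G3_rec v1E.
  + by rewrite [LHS]G3_rec v1E.
  + by rewrite [LHS]G3_rec d0E addr0.
have F4E : F13_2 4 = G4 false false (o4 3).
  by rewrite F13_2E; congr (G _ _); apply: val_inj.
(* Last letters are identified when their tests [a < 1] and [a < 2] agree; the test for a letter
   already forbidden is absorbed by [||]. *)
have d0E : G4 true true (o4 0) = G4 true true (o4 3).
  by rewrite [LHS]G4_rec [RHS]G4_rec.
have dE : G4 true true (o4 3) =
    1 + x * (G4 true true (o4 3) + G4 true true (o4 3)).
  by rewrite [LHS]G4_rec d0E !addr0.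
have b2E : G4 true false (o4 2) = G4 true false (o4 3).
  by rewrite [LHS]G4_rec [RHS]G4_rec.
have c1E : G4 false true (o4 1) = G4 false true (o4 3).
  by rewrite [LHS]G4_rec [RHS]G4_rec.
have e2E : G4 false false (o4 2) = G4 false false (o4 3).
  by rewrite [LHS]G4_rec [RHS]G4_rec.
have bE : G4 true false (o4 3) *
    ((1 - 2 * x) * (1 - 3 * x + x ^+ 2)) = (1 - x) ^+ 2.
  apply: (three_state_system (u := G4 true false (o4 0))
    (d := G4 true true (o4 3))) => //.
  + by rewrite [LHS]G4_rec b2E addr0.
  + by rewrite [LHS]G4_rec b2E addr0.
have cE : G4 false true (o4 3) *
    ((1 - 2 * x) * (1 - 3 * x + x ^+ 2)) = (1 - x) ^+ 2.
  apply: (three_state_system (u := G4 false true (o4 0))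
    (d := G4 true true (o4 3))) => //.
  + by rewrite [LHS]G4_rec c1E addr0.
  + by rewrite [LHS]G4_rec c1E addr0.
(* Forbidding 1 and forbidding 2 lead to the same three-letter system, whose solution is unique
   because its denominator is a unit. *)
have cbE : G4 false true (o4 3) = G4 true false (o4 3).
  have uD : (1 - 2 * x) * (1 - 3 * x + x ^+ 2) \is a GRing.unit.
    by rewrite unitrM u2.
  by apply: (mulIr uD); rewrite bE cE.
rewrite F4E; apply: (five_state_system (e0 := G4 false false (o4 0))
  (e1 := G4 false false (o4 1)) u1 _ _ _ dE bE).
- by rewrite [LHS]G4_rec b2E.
- by rewrite [LHS]G4_rec e2E cbE.
- by rewrite [LHS]G4_rec e2E.
Qed.
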